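(* Let $K\ge2$. For every bandit problem $\underline\nu=(\nu_k)_{k\in[K]}$ in $\mathcal{D}_{-,+}$ and every suboptimal arm $a$ (i.e., $\Delta_a>0$), one has $\mathcal{K}_{\inf}(\nu_a,\mu^\star,\mathcal{D}_{-,+})=0$; consequently, every strategy that is uniformly fast convergent on $\mathcal{D}_{-,+}$ satisfies, for every bandit problem $\underline\nu$ in $\mathcal{D}_{-,+}$ with at least one suboptimal arm, \[ \liminf_{T\to\infty}\frac{R_T(\underline\nu)}{\ln T}=+\infty . \] The same holds with $\mathcal{D}_{-,+}$ replaced by $\mathcal{D}_{m,+}$ for any $m\in\mathbb{R}$ (both in the vanishing of $\mathcal{K}_{\inf}$ and in the conclusion for strategies uniformly fast convergent on $\mathcal{D}_{m,+}$).
   Context: Stochastic $K$-armed bandit: arm $a$ has distribution $\nu_a$ with mean $\mu_a$, $\mu^\star=\max_a\mu_a$, $\Delta_a=\mu^\star-\mu_a$; at each round the player picks $A_t$ based on past observations and auxiliary independent uniform randomization and receives a reward drawn from $\nu_{A_t}$; $R_T(\underline\nu)=T\mu^\star-\mathbb{E}[\sum_{t\le T}\mu_{A_t}]$. For $m<M$, $\mathcal{D}_{m,M}$ is the set of probability distributions supported on $[m,M]$; $\mathcal{D}_{-,+}=\bigcup_{m<M}\mathcal{D}_{m,M}$ and, for $m\in\mathbb{R}$, $\mathcal{D}_{m,+}=\bigcup_{M>m}\mathcal{D}_{m,M}$. A strategy is uniformly fast convergent on a model $\mathcal{D}$ if for every bandit problem $\underline\nu$ in $\mathcal{D}$ and every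 $\beta\in(0,1]$, $R_T(\underline\nu)/T^{\beta}\to0$. For a distribution $\nu$, $x\in\mathbb{R}$ and a model $\mathcal{D}$, $\mathcal{K}_{\inf}(\nu,x,\mathcal{D})=\inf\{\mathrm{KL}(\nu,\nu'):\nu'\in\mathcal{D},\ \mathbb{E}(\nu')>x\}$ (infimum of the empty set is $+\infty$), where $\mathrm{KL}$ is the Kullback–Leibler divergence and $\mathbb{E}(\nu')$ the mean of $\nu'$. *)

(* Defs.v *)
From HB Require Import structures.
From mathcomp Require Import all_boot all_order all_algebra.
From mathcomp Require Import all_classical all_reals all_analysis.
Set Implicit Arguments. Unset Strict Implicit. Unset Printing Implicit Defensive.
Import Order.TTheory GRing.Theory Num.Theory.
Local Open Scope classical_set_scope.
Local Open Scope ring_scope.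

Section defs.
Context {R : realType}.

Definition distr := probability R R.

Definition mean (P : distr) : R := fine (\int[P]_x (x%:E))%E.

Definition KL (P Q : distr) : \bar R :=
  if pselect (P `<< Q) then
    (\int[P]_x (ln (fine (Radon_Nikodym (charge_of_finite_measure P) Q x)))%:E)%E
  else +oo%E.

Definition unif01 := uniform_prob (@ltr01 R).

Definition in_Dint (m M : R) (P : distr) : Prop := P `[m, M]%classic = 1%E.
Definition in_Dmp (P : distr) : Prop := exists m M : R, m < M /\ in_Dint m M P.
Definition in_Dmplus (m : R) (P : distr) : Prop := exists M : R, m < M /\ in_Dint m M P.

Definition Kinf (P : distr) (x : R) (D : distr -> Prop) : \bar R :=
  ereal_inf [set KL P Q | Q in [set Q | D Q /\ x < mean Q]].

Variable K : nat.

Definition mustar (nu : 'I_K -> distr) : R :=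
  fine (\big[Order.max/-oo%E]_(a < K) (mean (nu a))%:E).

Definition gap (nu : 'I_K -> distr) (a : 'I_K) : R := mustar nu - mean (nu a).

Definition strategy := nat -> seq R -> seq R -> 'I_K.

Definition strategy_measurable (psi : strategy) : Prop :=
  forall (t : nat) (a : 'I_K),
    measurable [set z : t.-tuple R * t.+1.-tuple R | psi t z.1 z.2 = a].

Fixpoint Eval (nu : 'I_K -> distr) (psi : strategy) (n : nat)
  (f : seq R -> seq R -> \bar R) (ys us : seq R) : \bar R :=
  match n with
  | 0 => f ys us
  | n'.+1 => (\int[nu (psi (size ys) ys us)]_y
               \int[unif01]_u Eval nu psi n' f (rcons ys y) (rcons us u))%E
  end.

Definition Ehist (nu : 'I_K -> distr) (psi : strategy) (t : nat)
  (f : seq R -> seq R -> \bar R) : \bar R :=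
  (\int[unif01]_u0 Eval nu psi t f [::] [:: u0])%E.

Definition regret (nu : 'I_K -> distr) (psi : strategy) (T : nat) : R :=
  T%:R * mustar nu -
  \sum_(t < T) fine (Ehist nu psi t
                       (fun ys us => (mean (nu (psi (size ys) ys us)))%:E)).

Definition uniformly_fast_convergent (D : distr -> Prop) (psi : strategy) : Prop :=
  forall nu : 'I_K -> distr, (forall a, D (nu a)) ->
  forall beta : R, 0 < beta <= 1 ->
    (fun T : nat => regret nu psi T / (T%:R `^ beta)) @ \oo --> 0.

Definition liminf_regret_over_log (nu : 'I_K -> distr) (psi : strategy) : \bar R :=
  limn_einf (fun T : nat => (regret nu psi T / ln T%:R)%:E).
End defs.

(* Main.v *)
(* Replace the law [P] of the suboptimal arm by [Q = q P + (1 - q) delta_x0].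
   With [x0] beyond the support of [P] the density of [P] with respect to [Q] is
   [1 / q], so that [KL(P, Q) = - ln q] is as small as desired, while the mean
   of [Q] exceeds the optimal mean as soon as [x0] is large.

   For the regret, [q P <= Q] gives a change of measure without likelihood
   ratios: an event on which the arm is played at most [m] times is at most
   [q^-m] times as likely in the original problem as in the modified one, where
   the arm is the unique optimal one and is hence played in all but
   [o(sqrt T)] of the rounds.  Taking [m = C ln T] and [q^m = 1 / sqrt T], the
   arm must be played of the order of [m] times in expectation, and [C] is
   arbitrary. *)
Require Import Defs.
From HB Require Import structures.
From mathcomp Require Import all_boot all_order all_algebra.
From mathcomp Require Import all_classical all_reals all_analysis.
From mathcomp Require Import measurable_realfun zify ring lra.
Import Order.TTheory GRing.Theory Num.Theory.
Import numFieldNormedType.Exports.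
Local Open Scope classical_set_scope.
Local Open Scope ring_scope.
Set Implicit Arguments.
Unset Strict Implicit.
Unset Printing Implicit Defensive.

(** * Nonnegativity of the Kullback-Leibler divergence *)

Section KL_nonnegativity.
Context {R : realType}.
Implicit Types P Q : @distr R.

(** Comparing positive and negative parts separately avoids any integrability assumption: the
    logarithm of a density may well have an infinite integral. *)
Lemma le_integral_measurable d (T : measurableType d)
    (mu : {measure set T -> \bar R}) (f g : T -> \bar R) :
  measurable_fun setT f -> measurable_fun setT g ->
  (forall x, f x <= g x)%E -> (\int[mu]_x f x <= \int[mu]_x g x)%E.
Proof.
move=> mf mg fg; rewrite integralE [leRHS]integralE; apply: leeB.
- apply: ge0_le_integral => //.
  + exact: measurable_funepos.
  + exact: measurable_funepos.
  + by move=> x _; apply: (@funepos_le _ _ setT) => //; rewrite inE.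
- apply: ge0_le_integral => //.
  + exact: measurable_funeneg.
  + exact: measurable_funeneg.
  + by move=> x _; apply: (@funeneg_le _ _ setT) => //; rewrite inE.
Qed.

(** Two versions of the density agree [Q]-a.e., hence [P]-a.e. by domination. The version chosen
    here is finite and nonnegative everywhere and obeys a change of variables formula. *)
Lemma KLE P Q : P `<< Q ->
  KL P Q = (\int[P]_x (ln (fine (Radon_Nikodym_SigmaFinite.f P Q x)))%:E)%E.
Proof.
move=> PQ; rewrite /KL; case: pselect => //= _.
have mRN : measurable_fun setT (Radon_Nikodym (charge_of_finite_measure P) Q).
  exact: (measurable_int _
    (@Radon_Nikodym_integrable _ _ R (charge_of_finite_measure P) Q PQ)).
have mf : measurable_fun setT (Radon_Nikodym_SigmaFinite.f P Q).
  exact: (measurable_int _ (Radon_Nikodym_SigmaFinite.f_integrable PQ)).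
have mlnfine (F : R -> \bar R) : measurable_fun setT F ->
    measurable_fun setT (fun x => (ln (fine (F x)))%:E).
  move=> mF; apply/measurable_EFinP.
  exact: (measurableT_comp (@measurable_ln R)
    (measurableT_comp (@fine_measurable R _ measurableT) mF)).
apply: ae_eq_integral => //.
- exact: mlnfine mRN.
- exact: mlnfine mf.
- apply: (ae_eq_comp (fun e => (ln (fine e))%:E)).
  apply: (null_dominates_ae_eq measurableT PQ).
  by apply: ae_eq_sym; exact: ae_eq_Radon_Nikodym_SigmaFinite.
Qed.

(* [ln x >= 1 - 1/x], and the reciprocal of the density has [P]-integral at
   most 1; the indicator absorbs the junk values at a vanishing density. *)
Lemma KL_ge0 P Q : (0 <= KL P Q)%E.
Proof.
have [PQ|nPQ] := pselect (P `<< Q); last first.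
  by rewrite /KL; case: pselect.
rewrite KLE//; set F := Radon_Nikodym_SigmaFinite.f P Q.
have F0 x : (0 <= F x)%E by exact: Radon_Nikodym_SigmaFinite.f_ge0.
have Ffin x : F x \is a fin_num by exact: Radon_Nikodym_SigmaFinite.f_fin_num.
have mF : measurable_fun setT F.
  exact: (measurable_int _ (Radon_Nikodym_SigmaFinite.f_integrable PQ)).
pose G x := fine (F x).
have FG x : F x = (G x)%:E by rewrite fineK.
have G0 x : 0 <= G x by rewrite fine_ge0.
have mG : measurable_fun setT G by exact: measurableT_comp.
have mGV : measurable_fun setT (fun x => (G x)^-1).
  rewrite (_ : (fun _ => _) = @powR R ^~ (- 1) \o G).
    exact: measurableT_comp (measurable_powR _) mG.
  by apply/funext => x /=; rewrite powR_inv1.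
pose D := [set x | 0 < G x].
have mD : measurable D.
  rewrite (_ : D = G @^-1` `]0, +oo[).
    by rewrite -[X in measurable X]setTI; exact: mG.
  by apply/seteqP; split => x; rewrite /D /= in_itv/= andbT.
have PD : P D = 1%E.
  have : P (~` D) = 0%E.
    rewrite (Radon_Nikodym_SigmaFinite.f_integral PQ (measurableC mD)).
    apply: integral0_eq => x /= /negP; rewrite -leNgt => Gx.
    by rewrite -/F FG; congr (_%:E); apply/eqP; rewrite eq_le Gx G0.
  rewrite probability_setC// => /eqP.
  rewrite -[P D]fineK ?fin_num_measure// -EFinB eqe subr_eq0 => /eqP ->.
  by [].
(* Integrating against [Q] instead multiplies [1 / G] by [G], which leaves the indicator of [D];
   since [0^-1 = 0], this also holds where [G] vanishes. *)
have GV1 : (\int[P]_x ((G x)^-1)%:E <= 1)%E.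
  rewrite -(Radon_Nikodym_SigmaFinite.change_of_variables PQ) => //; last 2 first.
    by move=> x; rewrite lee_fin invr_ge0.
    exact/measurable_EFinP.
  rewrite (eq_integral (EFin \o \1_D)); last first.
    move=> x _ /=; rewrite -/F FG -EFinM indicE; congr (_%:E).
    have [xD|xD] := boolP (x \in D).
      by rewrite mulVf// gt_eqF//; move: xD; rewrite inE.
    suff -> : G x = 0 by rewrite mulr0.
    by apply/eqP; rewrite eq_le G0 andbT leNgt; apply: contra xD; rewrite inE.
  by rewrite integral_indic// setIT probability_le1.
have iGV : P.-integrable setT (EFin \o (fun x => (G x)^-1)).
  apply/integrableP; split; first exact/measurable_EFinP.
  apply: le_lt_trans (ltry 1); apply: le_trans GV1.
  by under eq_integral do rewrite /= ger0_norm ?invr_ge0//.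
apply: (@le_trans _ _ (\int[P]_x ((\1_D x)%:E - ((G x)^-1)%:E))%E); last first.
  apply: le_integral_measurable.
  - apply: emeasurable_funB; first exact/measurable_EFinP/measurable_indic.
    exact/measurable_EFinP.
  - by apply/measurable_EFinP/measurableT_comp.
  - move=> x; rewrite -EFinB lee_fin -/F -/(G x) indicE.
    have [xD|xD] := boolP (x \in D).
      have {xD} Gx : 0 < G x by move: xD; rewrite inE.
      have V : ln (G x)^-1 = - ln (G x) by rewrite lnV// posrE.
      have := @le_ln1Dx R ((G x)^-1 - 1).
      rewrite ltrBrDl subrr invr_gt0 Gx => /(_ isT).
      by rewrite addrCA subrr addr0 V mulr1n; lra.
    (* Off [D], [ln 0] and [0^-1] are both 0 by convention, so the inequality reads [0 <= 0]. *)
    have -> : G x = 0.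
      by apply/eqP; rewrite eq_le G0 andbT leNgt; apply: contra xD; rewrite inE.
    by rewrite ln0// invr0 mulr0n subr0.
rewrite integralB//; last first.
  exact: integrable_indic.
rewrite integral_indic// ?setIT sube_ge0; last first.
  by rewrite (integrable_fin_num measurableT iGV).
have P1 : (1 <= P D)%E by rewrite PD.
exact: le_trans GV1 P1.
Qed.

End KL_nonnegativity.

(** * Mixtures of a law with a Dirac mass *)

Section mixture.
Context {R : realType}.
Variables (P : @distr R) (q : {i01 R}) (x0 : R).

Definition mix : set R -> \bar R :=
  measure_add (mscale q%:num%:nng P) (mscale (1 - q%:num)%:nng \d_x0).

HB.instance Definition _ := Measure.on mix.

Lemma mixE A : mix A = (q%:num%:E * P A + (1 - q%:num)%:E * \d_x0 A)%E.
Proof. by rewrite /mix measure_addE. Qed.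

Let mix_setT : mix setT = 1%E.
Proof. by rewrite mixE probability_setT diracT !mule1 -EFinD addrC subrK. Qed.

HB.instance Definition _ := Measure_isProbability.Build _ _ _ mix mix_setT.

End mixture.

Section mixture_theory.
Context {R : realType}.
Variables (P : @distr R) (q : {i01 R}) (x0 : R).
Local Notation Q := (mix P q x0).

Lemma integrable_mscale d (T : measurableType d) (mu : {measure set T -> \bar R})
    (k : {nonneg R}) (f : T -> \bar R) :
  mu.-integrable setT f -> (mscale k mu).-integrable setT f.
Proof.
move=> /integrableP[mf foo]; apply/integrableP; split => //.
rewrite ge0_integral_mscale//; last exact: measurableT_comp.
by rewrite lte_mul_pinfty.
Qed.

Lemma integral_mscale d (T : measurableType d) (mu : {measure set T -> \bar R})
    (k : {nonneg R}) (f : T -> \bar R) :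
  mu.-integrable setT f ->
  (\int[mscale k mu]_x f x = k%:num%:E * \int[mu]_x f x)%E.
Proof.
move=> fi; have mf := measurable_int _ fi.
rewrite (integralE (mscale k mu) setT f) (integralE mu setT f).
rewrite (ge0_integral_mscale mu measurableT k (measurable_funepos mf))//.
rewrite (ge0_integral_mscale mu measurableT k (measurable_funeneg mf))//.
by apply/esym/muleBr => //; exact: integrable_add_def.
Qed.

Lemma integral_mix (f : R -> R) : P.-integrable setT (EFin \o f) ->
  (\int[Q]_x (f x)%:E =
   q%:num%:E * \int[P]_x (f x)%:E + (1 - q%:num)%:E * (f x0)%:E)%E.
Proof.
move=> fi; have mf := measurable_int _ fi.
have di : (\d_x0 : {measure set R -> \bar R}).-integrable setT (EFin \o f).
  apply/integrableP; split => //.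
  rewrite integral_dirac//; last exact: measurableT_comp.
  by rewrite diracT mul1e /= ltry.
rewrite /mix integral_measure_add//.
- rewrite integral_mscale//= integral_mscale// integral_dirac//.
  by rewrite diracT mul1e.
- exact: integrable_mscale.
- exact: integrable_mscale.
Qed.

Hypothesis q0 : 0 < q%:num.

Lemma dominates_mix : P `<< Q.
Proof.
apply/null_content_dominatesP => A mA QA0.
apply/eqP; rewrite eq_le measure_ge0 andbT.
have : (q%:num%:E * P A <= 0)%E.
  by rewrite -QA0 /= mixE leeDl// mule_ge0// lee_fin subr_ge0.
by rewrite pmule_rle0 ?lte_fin.
Qed.

(** Off [x0] the mixture is [q P], and [P] ignores [x0], so the density of [P] is [1 / q] off [x0]
    and 0 at [x0]; its logarithm is [P]-a.e. constant. *)
Lemma KL_mix : P [set x0] = 0%E -> KL P Q = (- ln q%:num)%:E.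
Proof.
move=> Px0; have PQ := dominates_mix; rewrite KLE//.
pose D := ~` [set x0].
have mD : measurable D by exact: measurableC.
pose k := q%:num^-1.
have densE : ae_eq Q setT (fun x => (k * \1_D x)%:E)
    (Radon_Nikodym_SigmaFinite.f P Q).
  apply: integral_ae_eq => //.
  - rewrite (_ : (fun _ => _) = (fun x => k%:E * (\1_D x)%:E)%E)//.
    by apply: integrableZl => //; exact: integrable_indic.
  - exact: measurable_int _ (Radon_Nikodym_SigmaFinite.f_integrable PQ).
  - move=> A _ mA; rewrite -Radon_Nikodym_SigmaFinite.f_integral//.
    under eq_integral do rewrite EFinM.
    rewrite ge0_integralZl//; last 2 first.
      exact/measurable_EFinP/measurable_indic.
      by rewrite lee_fin invr_ge0 ltW.
    (* The Dirac mass does not see the part of [A] off [x0], and [k] cancels [q]; it remains to see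
       that removing [x0] from [A] does not change [P A]. *)
    rewrite integral_indic//= mixE diracE memNset; last by case=> h _; exact: h.
    rewrite mule0 adde0 muleA -EFinM mulVf ?gt_eqF// mul1e.
    rewrite -[in RHS](setIT A) -(setUv [set x0]) setIUr measureU//; last 3 first.
      exact: measurableI.
      exact: measurableI.
      by rewrite setIACA setICr setI0.
    rewrite [X in (X + _)%E](_ : _ = 0%E) ?add0e 1?setIC//.
    apply/eqP; rewrite eq_le measure_ge0 andbT -Px0.
    by apply: le_measure => //; rewrite ?inE//; exact: measurableI.
have := null_dominates_ae_eq measurableT PQ densE.
move=> /(ae_eq_comp (fun e => (ln (fine e))%:E)) aeE.
have Dk : ae_eq P setT (fun x => (ln (fine (k * \1_D x)%:E))%:E) (cst (ln k)%:E).
  exists [set x0]; split => // x /= h; apply: contrapT => xx0; apply: h => _.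
  by rewrite indicE mem_set// mulr1.
have mln (g : R -> R) : measurable_fun setT g ->
    measurable_fun setT (fun x => (ln (g x))%:E).
  by move=> mg; apply/measurable_EFinP; exact: measurableT_comp mg.
rewrite -(ae_eq_integral _ _ _ _ _ aeE)//; last 2 first.
- by apply: mln; apply: measurable_funM => //; exact: measurable_indic.
- apply: mln; apply: (measurableT_comp (@fine_measurable R _ measurableT)).
  exact: (measurable_int _ (Radon_Nikodym_SigmaFinite.f_integrable PQ)).
rewrite (ae_eq_integral _ _ _ _ _ Dk)//; last first.
  by apply: mln; apply: measurable_funM => //; exact: measurable_indic.
rewrite integral_cst// [X in (_ * X)%E](_ : _ = 1%E); last exact: probability_setT.
by rewrite mule1 lnV.
Qed.

End mixture_theory.

(** * Laws with bounded support *)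

Section bounded_support.
Context {R : realType}.
Implicit Types P : @distr R.

Lemma in_Dint_setC0 (m M : R) P : in_Dint m M P -> P (~` `[m, M]) = 0%E.
Proof.
by move=> h; rewrite probability_setC// [P _]h subee.
Qed.

Lemma in_Dint_integrable (m M : R) P : in_Dint m M P ->
  P.-integrable setT (EFin \o id).
Proof.
move=> /in_Dint_setC0 PC0.
have mI : measurable (~` `[m, M] : set R) by apply: measurableC.
apply/(negligible_integrable mI measurableT _ PC0) => //.
  exact/measurable_EFinP.
rewrite setTD setCK; apply: measurable_bounded_integrable => //.
  exact: le_lt_trans (probability_le1 _ _) (ltry _).
exists (`|m| + `|M|); split => // r rb x /=; rewrite in_itv/= => /andP[mx xM].
apply: le_trans (ltW rb); rewrite ler_norml; apply/andP; split.
  by have := ler_norm (- m); have := normr_ge0 M; rewrite normrN; lra.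
by have := ler_norm M; have := normr_ge0 m; lra.
Qed.

Lemma mean_mix (m M : R) P q x0 : in_Dint m M P ->
  mean (mix P q x0) = q%:num * mean P + (1 - q%:num) * x0.
Proof.
move=> /in_Dint_integrable Pid; rewrite /mean integral_mix//.
have fin := integrable_fin_num measurableT Pid.
by rewrite fineD ?fin_numM// fineM// fineM.
Qed.

Lemma in_Dint_mix (m M x0 : R) P q : m < M -> M < x0 -> in_Dint m M P ->
  in_Dint m x0 (mix P q x0).
Proof.
move=> mM Mx0 h; rewrite /in_Dint /= mixE.
have -> : P `[m, x0]%classic = 1%E.
  apply/eqP; rewrite eq_le probability_le1//= -h le_measure ?inE//.
  by move=> x /=; rewrite !in_itv/= => /andP[-> /le_trans ->//]; exact: ltW.
rewrite diracE mem_set/=; last by rewrite in_itv/= lexx (ltW (lt_trans mM Mx0)).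
by rewrite !mule1 -EFinD addrC subrK.
Qed.

Lemma in_Dint_set1 (m M x0 : R) P : M < x0 -> in_Dint m M P ->
  P [set x0] = 0%E.
Proof.
move=> Mx0 /in_Dint_setC0 PC0; apply/eqP; rewrite eq_le measure_ge0 andbT -PC0.
rewrite le_measure ?inE//; first exact: measurableC.
by move=> _ -> /=; rewrite in_itv/= => /andP[_]; rewrite leNgt Mx0.
Qed.

End bounded_support.

(** * Vanishing of the infimum of divergences *)

Section unbounded_models.
Context {R : realType}.
Implicit Types (P : @distr R) (D : @distr R -> Prop).

(** The common feature of the two kinds of models: mass may be moved arbitrarily far to the right,
    the lower end of the support being kept. *)
Definition unbounded_model D := forall P, D P ->
  exists m M : R, [/\ m < M, in_Dint m M P &
    forall (q : {i01 R}) (x0 : R), M < x0 -> D (mix P q x0)].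

Lemma unbounded_model_Dmp : unbounded_model in_Dmp.
Proof.
move=> P [m [M [mM PmM]]]; exists m, M; split => // q x0 Mx0.
by exists m, x0; split; [exact: lt_trans Mx0|exact: in_Dint_mix PmM].
Qed.

Lemma unbounded_model_Dmplus (m : R) : unbounded_model (in_Dmplus m).
Proof.
move=> P [M [mM PmM]]; exists m, M; split => // q x0 Mx0.
by exists x0; split; [exact: lt_trans Mx0|exact: in_Dint_mix PmM].
Qed.

Lemma exists_mix_mean_gt D P (q : {i01 R}) (mu : R) :
    unbounded_model D -> D P -> q%:num < 1 ->
  exists x0, [/\ P [set x0] = 0%E, D (mix P q x0) & mu < mean (mix P q x0)].
Proof.
move=> uD DP q1; have [m [M [mM PmM Dmix]]] := uD _ DP.
(* The first term puts [x0] beyond the support. The second is the solution of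
   [q * mean P + (1 - q) * x0 = mu], plus 1 for strictness. *)
pose x0 := Num.max (M + 1) ((mu - q%:num * mean P) / (1 - q%:num) + 1).
have Mx0 : M < x0 by rewrite /x0 lt_max ltrDl ltr01.
exists x0; split; [exact: in_Dint_set1 Mx0 PmM|exact: Dmix|].
rewrite (mean_mix _ _ PmM) -ltrBlDl.
have q1' : 0 < 1 - q%:num by rewrite subr_gt0.
rewrite [ltRHS]mulrC -ltr_pdivrMr//.
apply: (@lt_le_trans _ _ ((mu - q%:num * mean P) / (1 - q%:num) + 1)).
  by rewrite ltrDl.
by rewrite /x0 le_max lexx orbT.
Qed.

Lemma Kinf_eq0 D P (x : R) : unbounded_model D -> D P -> Kinf P x D = 0%E.
Proof.
move=> uD DP; apply/eqP; rewrite eq_le; apply/andP; split; last first.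
  by apply/ereal_infP => _ [Q _ <-]; exact: KL_ge0.
apply/lee_addgt0Pr => e e0; rewrite add0e.
(* With [q = exp (- e)] the divergence to the mixture is exactly [e]. *)
have q0 : 0 < expR (- e) by exact: expR_gt0.
have q1 : expR (- e) < 1 by rewrite expR_lt1 oppr_lt0.
pose q : {i01 R} := Itv01 (ltW q0) (ltW q1).
have [x0 [Px0 DQ xQ]] := exists_mix_mean_gt (q := q) x uD DP q1.
apply: ge_ereal_inf; exists (KL P (mix P q x0)); first by exists (mix P q x0).
by rewrite KL_mix//= expRK opprK.
Qed.

End unbounded_models.

(** * Real-valued integration of bounded measurable functions *)

Section bounded_measurable.
Context {R : realType}.

Definition bounded_measurable d (T : measurableType d) (f : T -> R) :=
  measurable_fun setT f /\ exists C : R, forall x, `|f x| <= C.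

Lemma bm_cst d (T : measurableType d) (c : R) :
  bounded_measurable (fun _ : T => c).
Proof. by split => //; exists `|c|. Qed.

Lemma bm_lin d (T : measurableType d) (a b : R) (f g : T -> R) :
  bounded_measurable f -> bounded_measurable g ->
  bounded_measurable (fun x => a * f x + b * g x).
Proof.
move=> [mf [C fC]] [mg [C' gC']]; split.
  by apply: measurable_funD; apply: measurable_funM.
exists (`|a| * C + `|b| * C') => x; apply: le_trans (ler_normD _ _) _.
by rewrite !normrM lerD// ler_wpM2l.
Qed.

Lemma bm_comp d d' (T : measurableType d) (U : measurableType d')
    (h : U -> T) (f : T -> R) :
  measurable_fun setT h -> bounded_measurable f -> bounded_measurable (f \o h).
Proof.
move=> mh [mf [C fC]]; split; first exact: measurableT_comp mf mh.
by exists C => x /=.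
Qed.

Section probability_integral.
Context d (T : measurableType d) (P : probability T R).
Implicit Types f g : T -> R.

Lemma bm_integrable f : bounded_measurable f -> P.-integrable setT (EFin \o f).
Proof.
move=> [mf [C fC]]; apply: measurable_bounded_integrable => //.
  exact: le_lt_trans (probability_le1 P measurableT) (ltry _).
exists C; split; first exact: num_real.
by move=> r Cr x _; exact: le_trans (fC x) (ltW Cr).
Qed.

Lemma EFin_Rintegral f : bounded_measurable f ->
  (\int[P]_x (f x)%:E)%E = (\int[P]_x f x)%:E.
Proof.
by move=> bf; rewrite fineK//; exact/integrable_fin_num/bm_integrable.
Qed.

Lemma Rint_cst (c : R) : \int[P]_x c = c.
Proof.
rewrite Rintegral_cst// [X in fine X](_ : _ = 1%E) ?mulr1//.
exact: probability_setT.
Qed.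

Lemma Rint_lin (a b : R) f g : bounded_measurable f -> bounded_measurable g ->
  \int[P]_x (a * f x + b * g x) = a * \int[P]_x f x + b * \int[P]_x g x.
Proof.
move=> /bm_integrable fi /bm_integrable gi.
have Zi (c : R) (h : T -> R) : P.-integrable setT (EFin \o h) ->
    P.-integrable setT (EFin \o (fun x => c * h x)).
  move=> hi; rewrite (_ : _ \o _ = fun x => (c%:E * (EFin \o h) x)%E)//.
  exact: integrableZl.
by rewrite RintegralD ?RintegralZl//; exact: Zi.
Qed.

Lemma le_Rint f g : bounded_measurable f -> bounded_measurable g ->
  (forall x, f x <= g x) -> \int[P]_x f x <= \int[P]_x g x.
Proof.
by move=> bf bg fg; apply: le_Rintegral => //; exact: bm_integrable.
Qed.

End probability_integral.

(** Measurability comes from Tonelli, which wants a nonnegative integrand: the bound [C] is added to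
    [f] and subtracted after integration, [P] having mass 1. *)
Lemma bm_Rintegral d d' (T : measurableType d) (U : measurableType d')
    (P : probability U R) (f : T * U -> R) :
  bounded_measurable f -> bounded_measurable (fun x => \int[P]_y f (x, y)).
Proof.
move=> bf; have [mf [C fC]] := bf.
have bsec x : bounded_measurable (fun y => f (x, y)).
  by apply: (bm_comp _ bf); exact: pair1_measurable.
split.
  pose F x := \int[P]_y (1 * f (x, y) + C * 1).
  have -> : (fun x => \int[P]_y f (x, y)) = (fun x => F x - C).
    apply/funext => x; rewrite /F Rint_lin//; last exact: bm_cst.
    by rewrite Rint_cst; lra.
  apply: measurable_funB => //.
  apply: (measurableT_comp (@fine_measurable R _ measurableT)).
  apply: (measurable_fun_fubini_tonelli_F (m2 := P)
    (fun z => (1 * f z + C * 1)%:E)).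
    by apply/measurable_EFinP/measurable_funD => //; exact: measurable_funM.
  move=> z; rewrite lee_fin mul1r mulr1 -lerBlDr sub0r.
  by have := fC z; rewrite ler_norml => /andP[].
exists C => x; rewrite ler_norml; apply/andP; split.
  rewrite -(Rint_cst P (- C)); apply: le_Rint => //; first exact: bm_cst.
  by move=> y; have := fC (x, y); rewrite ler_norml => /andP[].
rewrite -(Rint_cst P C); apply: le_Rint => //; first exact: bm_cst.
by move=> y; have := fC (x, y); rewrite ler_norml => /andP[].
Qed.

End bounded_measurable.

(** * Functions of the history and one-round expectations *)

Section histories.
Context {R : realType}.
Implicit Types (f g : seq R -> seq R -> R) (ys us : seq R).

(** After [t] rounds there are [t] rewards but [t + 1] uniform variables, one being drawn before the
    first round. The bound may depend on [t]. *)
Definition history_bm f := forall t : nat,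
  bounded_measurable (fun z : t.-tuple R * t.+1.-tuple R => f z.1 z.2).

Lemma history_bm_cst (c : R) : history_bm (fun _ _ => c).
Proof. by move=> t; exact: bm_cst. Qed.

Lemma history_bm_lin (a b : R) f g : history_bm f -> history_bm g ->
  history_bm (fun ys us => a * f ys us + b * g ys us).
Proof. by move=> nf ng t; exact: bm_lin. Qed.

Lemma measurable_rcons d (U : measurableType d) n
    (f : U -> n.-tuple R) (g : U -> R) :
  measurable_fun setT f -> measurable_fun setT g ->
  measurable_fun setT (fun x => [tuple of rcons (f x) (g x)]).
Proof.
move=> mf mg; apply/measurable_fun_tnthP => i.
have [ilt|ige] := ltnP i n.
  rewrite (_ : _ \o _ = fun x => tnth (f x) (Ordinal ilt)).
    exact: measurableT_comp (measurable_tnth _) mf.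
  apply/funext => x /=; rewrite (tnth_nth 0) [RHS](tnth_nth 0)/=.
  by rewrite nth_rcons size_tuple ilt.
rewrite (_ : _ \o _ = g)//; apply/funext => x /=; rewrite (tnth_nth 0)/=.
rewrite nth_rcons size_tuple ltnNge ige/=.
have -> : (i : nat) = n by apply/eqP; rewrite eqn_leq ige andbT -ltnS ltn_ord.
by rewrite eqxx.
Qed.

(** The conditional expectation of [f] one round later, given the history, when the next reward has
    law [P]. *)
Definition next_exp (P : @distr R) f ys us : R :=
  \int[P]_y \int[unif01]_u f (rcons ys y) (rcons us u).

Lemma history_bm_next (P : @distr R) f : history_bm f ->
  history_bm (next_exp P f).
Proof.
move=> nf t; rewrite /next_exp.
pose r1 (z : ((t.-tuple R * t.+1.-tuple R) * R) * R) :=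
  [tuple of rcons z.1.1.1 z.1.2].
pose r2 (z : ((t.-tuple R * t.+1.-tuple R) * R) * R) :=
  [tuple of rcons z.1.1.2 z.2].
have mr : measurable_fun setT (fun z => (r1 z, r2 z)).
  have m11 : measurable_fun setT
      (fun z : ((t.-tuple R * t.+1.-tuple R) * R) * R => z.1.1).
    exact: (measurableT_comp measurable_fst measurable_fst).
  apply: measurable_fun_pair; apply: measurable_rcons => //.
  - exact: (measurableT_comp measurable_fst m11).
  - exact: (measurableT_comp measurable_snd measurable_fst).
  - exact: (measurableT_comp measurable_snd m11).
have b1 := bm_comp mr (nf t.+1).
have b2 := bm_Rintegral unif01 b1.
exact: (bm_Rintegral P b2).
Qed.

Section fixed_history.
Variables (ys us : seq R).
Hypothesis hist : size us = (size ys).+1.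

Lemma bm_rcons f : history_bm f ->
  bounded_measurable (fun p : R * R => f (rcons ys p.1) (rcons us p.2)).
Proof.
move=> nf.
have us_size : size us == (size ys).+1 by rewrite hist.
pose r1 (p : R * R) := [tuple of rcons (in_tuple ys) p.1].
pose r2 (p : R * R) := [tuple of rcons (Tuple us_size) p.2].
have mr : measurable_fun setT (fun p => (r1 p, r2 p)).
  by apply: measurable_fun_pair; apply: measurable_rcons.
exact: (bm_comp mr (nf (size ys).+1)).
Qed.

Lemma bm_rcons_y f y : history_bm f ->
  bounded_measurable (fun u : R => f (rcons ys y) (rcons us u)).
Proof.
by move=> nf; exact: (bm_comp (pair1_measurable y) (bm_rcons nf)).
Qed.

Lemma bm_rcons_int f : history_bm f ->
  bounded_measurable (fun y : R => \int[unif01]_u f (rcons ys y) (rcons us u)).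
Proof. by move=> nf; exact: (bm_Rintegral unif01 (bm_rcons nf)). Qed.

Variable P : @distr R.

Lemma next_exp_cst (c : R) : next_exp P (fun _ _ => c) ys us = c.
Proof. by rewrite /next_exp !Rint_cst. Qed.

Lemma next_exp_lin (a b : R) f g : history_bm f -> history_bm g ->
  next_exp P (fun ys us => a * f ys us + b * g ys us) ys us =
  a * next_exp P f ys us + b * next_exp P g ys us.
Proof.
move=> nf ng; rewrite /next_exp.
rewrite -Rint_lin; [|exact: bm_rcons_int..].
by apply: eq_Rintegral => y _; rewrite Rint_lin//; exact: bm_rcons_y.
Qed.

Lemma le_next_exp f g : history_bm f -> history_bm g ->
  (forall y u, f (rcons ys y) (rcons us u) <= g (rcons ys y) (rcons us u)) ->
  next_exp P f ys us <= next_exp P g ys us.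
Proof.
move=> nf ng fg; apply: le_Rint => [||y].
- exact: bm_rcons_int.
- exact: bm_rcons_int.
- by apply: le_Rint => //; exact: bm_rcons_y.
Qed.

(** The domination of [q P] by the mixture, in integrated form: the Dirac part adds a nonnegative
    term. *)
Lemma le_next_exp_mix q x0 f : history_bm f ->
  (forall y u, 0 <= f (rcons ys y) (rcons us u)) ->
  q%:num * next_exp P f ys us <= next_exp (mix P q x0) f ys us.
Proof.
move=> nf f0; rewrite /next_exp; have bI := bm_rcons_int nf.
rewrite -lee_fin -EFin_Rintegral// integral_mix; last exact: bm_integrable.
rewrite EFin_Rintegral// EFinM leeDl// -EFinM lee_fin mulr_ge0 ?subr_ge0//.
by apply: Rintegral_ge0.
Qed.

Lemma EFin_next_exp f : history_bm f ->
  (\int[P]_y \int[unif01]_u (f (rcons ys y) (rcons us u))%:E)%E =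
  (next_exp P f ys us)%:E.
Proof.
move=> nf; rewrite -EFin_Rintegral; last exact: bm_rcons_int.
by apply: eq_integral => y _; rewrite EFin_Rintegral//; exact: bm_rcons_y.
Qed.

End fixed_history.
End histories.

(** * Expectations under a strategy *)

Section strategies.
Context {R : realType} (K : nat) (psi : @strategy R K).
Hypothesis mpsi : strategy_measurable psi.
Implicit Types (f g : seq R -> seq R -> R) (ys us : seq R).
Implicit Types (nu : 'I_K -> @distr R).

Local Notation arm ys us := (psi (size ys) ys us).

(** There are finitely many arms, so gluing along the measurable events on which each arm is chosen
    keeps measurability, and the sum of the bounds serves all arms. *)
Lemma history_bm_select (G : 'I_K -> seq R -> seq R -> R) :
  (forall b, history_bm (G b)) -> history_bm (fun ys us => G (arm ys us) ys us).
Proof.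
move=> nG t; split.
  move=> _ Y mY; rewrite setTI.
  rewrite (_ : _ @^-1` _ = \big[setU/set0]_(b < K)
    ([set z : t.-tuple R * t.+1.-tuple R | psi t z.1 z.2 = b] `&`
     ((fun z : t.-tuple R * t.+1.-tuple R => G b z.1 z.2) @^-1` Y))).
    apply: bigsetU_measurable => b _; apply: measurableI; first exact: mpsi.
    by rewrite -[X in measurable X]setTI; apply: (nG b t).1.
  apply/seteqP; split => z /=; rewrite -bigcup_seq/=.
    rewrite size_tuple => YG; exists (psi t z.1 z.2) => //=.
    exact: mem_index_enum.
  by move=> [b _ [/= <-]]; rewrite size_tuple.
have [C GC] := fin_all_exists (fun b => (nG b t).2).
exists (\sum_b `|C b|) => z; apply: le_trans (GC _ z) _.
rewrite (bigD1 (arm z.1 z.2))//=; apply: le_trans (ler_norm _) _.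
by rewrite lerDl sumr_ge0.
Qed.

Lemma history_bm_arm (F : 'I_K -> R) : history_bm (fun ys us => F (arm ys us)).
Proof.
by apply: (@history_bm_select (fun b _ _ => F b)) => b; exact: history_bm_cst.
Qed.

(** The transition operator of the history process; its iterates are real-valued counterparts of
    [Eval]. *)
Definition step nu f ys us : R := next_exp (nu (arm ys us)) f ys us.

Lemma history_bm_step nu f : history_bm f -> history_bm (step nu f).
Proof.
move=> nf; apply: (@history_bm_select (fun b => next_exp (nu b) f)) => b.
exact: history_bm_next.
Qed.

Lemma history_bm_iter nu n f : history_bm f -> history_bm (iter n (step nu) f).
Proof. by move=> nf; elim: n => //= n; exact: history_bm_step. Qed.

Lemma Eval_EFin nu n f ys us : history_bm f -> size us = (size ys).+1 ->
  Eval nu psi n (fun ys us => (f ys us)%:E) ys us =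
  (iter n (step nu) f ys us)%:E.
Proof.
move=> nf; elim: n ys us => //= n IH ys us hist.
rewrite -(EFin_next_exp hist); last exact: history_bm_iter.
apply: eq_integral => y _; apply: eq_integral => u _.
by rewrite IH// !size_rcons hist.
Qed.

Lemma bm_initial f : history_bm f ->
  bounded_measurable (fun u : R => f [::] [:: u]).
Proof.
move=> nf.
have mr : measurable_fun setT (fun u : R => ([tuple] : 0.-tuple R, [tuple u])).
  apply: measurable_fun_pair => //; apply/measurable_fun_tnthP => i.
  by rewrite (_ : _ \o _ = id)//; apply/funext => u /=; rewrite ord1.
exact: (bm_comp mr (nf 0%N)).
Qed.

Definition expect nu t f : R :=
  \int[unif01]_u (iter t (step nu) f) [::] [:: u].

Lemma fine_Ehist nu t f : history_bm f ->
  fine (Ehist nu psi t (fun ys us => (f ys us)%:E)) = expect nu t f.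
Proof.
move=> nf; rewrite /Ehist /expect; congr fine.
by apply: eq_integral => u _; rewrite Eval_EFin.
Qed.

Lemma step_ge0 nu f ys us :
  (forall ys us, 0 <= f ys us) -> 0 <= step nu f ys us.
Proof. by move=> f0; apply: Rintegral_ge0 => y _; exact: Rintegral_ge0. Qed.

Lemma iter_step_cst nu n (c : R) ys us : size us = (size ys).+1 ->
  iter n (step nu) (fun _ _ => c) ys us = c.
Proof.
elim: n ys us => //= n IH ys us hist.
rewrite -[RHS](next_exp_cst ys us (nu (arm ys us)) c) /step /next_exp.
apply: eq_Rintegral => y _; apply: eq_Rintegral => u _.
by rewrite IH// !size_rcons hist.
Qed.

Lemma iter_step_lin nu n (a b : R) f g ys us : history_bm f -> history_bm g ->
  size us = (size ys).+1 ->
  iter n (step nu) (fun ys us => a * f ys us + b * g ys us) ys us =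
  a * iter n (step nu) f ys us + b * iter n (step nu) g ys us.
Proof.
move=> nf ng; elim: n ys us => //= n IH ys us hist.
rewrite /step -(next_exp_lin hist _ _ _ (history_bm_iter nu n nf)
  (history_bm_iter nu n ng)).
apply: eq_Rintegral => y _; apply: eq_Rintegral => u _.
by rewrite IH// !size_rcons hist.
Qed.

Lemma le_iter_step nu n f g ys us : history_bm f -> history_bm g ->
  (forall ys us, f ys us <= g ys us) -> size us = (size ys).+1 ->
  iter n (step nu) f ys us <= iter n (step nu) g ys us.
Proof.
move=> nf ng fg; elim: n ys us => [ys us _|n IH ys us hist]; first exact: fg.
apply: (le_next_exp hist _ (history_bm_iter nu n nf)
  (history_bm_iter nu n ng)) => y u.
by apply: IH; rewrite !size_rcons hist.
Qed.

Lemma expect_cst nu t (c : R) : expect nu t (fun _ _ => c) = c.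
Proof.
rewrite /expect -[RHS](Rint_cst unif01).
by apply: eq_Rintegral => u _; rewrite iter_step_cst.
Qed.

Lemma expect_lin nu t (a b : R) f g : history_bm f -> history_bm g ->
  expect nu t (fun ys us => a * f ys us + b * g ys us) =
  a * expect nu t f + b * expect nu t g.
Proof.
move=> nf ng; rewrite /expect -Rint_lin; [|exact/bm_initial/history_bm_iter..].
by apply: eq_Rintegral => u _; rewrite iter_step_lin.
Qed.

Lemma le_expect nu t f g : history_bm f -> history_bm g ->
  (forall ys us, f ys us <= g ys us) -> expect nu t f <= expect nu t g.
Proof.
move=> nf ng fg; apply: le_Rint => [||u]; [exact/bm_initial/history_bm_iter..|].
exact: le_iter_step.
Qed.

(** Given the history, the expected sum of [f] over [n] rounds, starting with the current
    history. *)
Definition total nu n f ys us : R := \sum_(t < n) iter t (step nu) f ys us.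

Lemma totalS nu n f ys us :
  total nu n.+1 f ys us = total nu n f ys us + iter n (step nu) f ys us.
Proof. by rewrite /total big_ord_recr. Qed.

Lemma history_bm_total nu n f : history_bm f -> history_bm (total nu n f).
Proof.
move=> nf; elim: n => [|n IH].
  rewrite (_ : total _ _ _ = fun _ _ => 0); first exact: history_bm_cst.
  by apply/funext => ys; apply/funext => us; rewrite /total big_ord0.
rewrite (_ : total _ _ _ = fun ys us =>
    1 * total nu n f ys us + 1 * iter n (step nu) f ys us).
  by apply: history_bm_lin => //; exact: history_bm_iter.
by apply/funext => ys; apply/funext => us; rewrite totalS !mul1r.
Qed.

Lemma total_ge0 nu n f ys us : (forall ys us, 0 <= f ys us) ->
  0 <= total nu n f ys us.
Proof.
move=> f0; apply: sumr_ge0 => t _; elim: (t : nat) ys us => //= k IH ys us.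
exact: step_ge0.
Qed.

(** Splits off the first round, where [totalS] splits off the last; this is the form that backward
    induction needs. *)
Lemma total_step nu n f ys us : history_bm f -> size us = (size ys).+1 ->
  total nu n.+1 f ys us = f ys us + step nu (total nu n f) ys us.
Proof.
move=> nf hist; elim: n => [|n IH].
  rewrite /total big_ord_recl big_ord0/= /step.
  rewrite (_ : (fun _ => _) = fun _ _ => 0) ?next_exp_cst//.
  by apply/funext => ys'; apply/funext => us'; rewrite big_ord0.
rewrite totalS IH -addrA; congr (_ + _).
have -> : total nu n.+1 f = fun ys us =>
    1 * total nu n f ys us + 1 * iter n (step nu) f ys us.
  by apply/funext => ys'; apply/funext => us'; rewrite totalS !mul1r.
rewrite /step (next_exp_lin hist _ _ _ (history_bm_total nu n nf)
  (history_bm_iter nu n nf)).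
by congr (_ + _); exact/esym/mul1r.
Qed.

End strategies.

(** * Change of measure for the numbers of plays *)

Section change_of_measure.
Context {R : realType} (K : nat) (psi : @strategy R K).
Hypothesis mpsi : strategy_measurable psi.
Implicit Types (nu : 'I_K -> @distr R) (f : seq R -> seq R -> R).

Local Notation arm ys us := (psi (size ys) ys us).

Definition play (S : pred 'I_K) (ys us : seq R) : R := (S (arm ys us))%:R.

Lemma history_bm_play S : history_bm (play S).
Proof. exact: (history_bm_arm mpsi (fun b => (S b)%:R)). Qed.

Definition expected_plays nu T (S : pred 'I_K) : R :=
  \sum_(t < T) expect psi nu t (play S).

Lemma integral_total nu T f : history_bm f ->
  \int[unif01]_u total psi nu T f [::] [:: u] = \sum_(t < T) expect psi nu t f.
Proof.
move=> nf; elim: T => [|T IH].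
  by rewrite big_ord0 -[RHS](Rint_cst unif01); apply: eq_Rintegral => u _;
    rewrite /total big_ord0.
rewrite big_ord_recr/= -IH /expect.
rewrite -[X in _ = X + _]mul1r -[X in _ = _ + X]mul1r.
rewrite -Rint_lin; last 2 first.
- exact/bm_initial/history_bm_total.
- exact/bm_initial/history_bm_iter.
by apply: eq_Rintegral => u _; rewrite totalS !mul1r.
Qed.

(** The maximum starts from [-oo]; the presence of the arm [b] makes it finite, so that [fine] loses
    nothing. *)
Lemma mean_le_mustar nu b : mean (nu b) <= mustar nu.
Proof.
rewrite /mustar -lee_fin [leRHS]fineK.
  exact: (@le_bigmax _ _ _ -oo%E (fun a => (mean (nu a))%:E) b).
have [i _ ->] := @eq_bigmax _ _ _ -oo%E b xpredT (fun a => (mean (nu a))%:E) isT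
  (fun a _ => leNye _).
by [].
Qed.

(** Each round played in [S] costs at least [D]. This serves both for the suboptimal arm in [nu] and
    for all other arms in the modified problem. *)
Lemma regret_ge nu T (S : pred 'I_K) (D : R) :
  (forall b, mean (nu b) + D * (S b)%:R <= mustar nu) ->
  D * expected_plays nu T S <= regret nu psi T.
Proof.
move=> muD; rewrite /regret /expected_plays mulr_sumr.
have -> : T%:R * mustar nu = \sum_(t < T) mustar nu.
  by rewrite sumr_const card_ord mulr_natl.
rewrite -sumrB; apply: ler_sum => t _.
have nm := history_bm_arm mpsi (fun b => mean (nu b)).
rewrite (fine_Ehist mpsi _ _ nm) lerBrDl.
have := expect_lin mpsi nu t 1 D nm (history_bm_play S); rewrite mul1r => <-.
rewrite -(expect_cst psi nu t (mustar nu)); apply: le_expect => //.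
- exact/history_bm_lin/history_bm_play.
- exact: history_bm_cst.
- by move=> ys us; rewrite mul1r muD.
Qed.

Variables (nu nu' : 'I_K -> @distr R) (a : 'I_K) (q : {i01 R}) (x0 : R).
Hypothesis nu'a : nu' a = mix (nu a) q x0.
Hypothesis nu'b : forall b, b != a -> nu' b = nu b.

(* [k] and [j] count the past rounds in which [a] was, resp. was not, played.
   Each play of [a] costs a factor [q] when passing from [nu] to [nu'] since
   [q (nu a) <= nu' a], so backward induction on the number [n] of remaining
   rounds propagates the deterministic inequality [base] of the horizon. *)
Lemma transport_le (T : nat) (c d : R) : 0 <= d ->
  (forall k, (k <= T)%N -> c <= q%:num ^+ k * (T - k)%:R + d * k%:R) ->
  forall n k j ys us, size us = (size ys).+1 -> (k + j + n = T)%N ->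
  c <= q%:num ^+ k * (j%:R + total psi nu' n (play (predC1 a)) ys us) +
       d * (k%:R + total psi nu n (play (pred1 a)) ys us).
Proof.
move=> d0 base; elim => [|n IH] k j ys us hist kjn.
  rewrite /total !big_ord0 !addr0; apply: le_trans (base k _) _.
    by rewrite -kjn addn0 leq_addr.
  by rewrite -kjn addn0 addKn.
rewrite !total_step//; [|exact: history_bm_play..].
set A := total psi nu n _; set B := total psi nu' n _.
have bA : history_bm A by exact/history_bm_total/history_bm_play.
have bB : history_bm B by exact/history_bm_total/history_bm_play.
have B0 ys' us' : 0 <= B ys' us' by apply: total_ge0 => ? ?; exact: ler0n.
have integrate (P : @distr R) (e w : R) :
    (forall y u, e <= w * B (rcons ys y) (rcons us u) +
                      d * A (rcons ys y) (rcons us u)) ->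
    e <= w * next_exp P B ys us + d * next_exp P A ys us.
  move=> ewd; rewrite -next_exp_lin// -[leLHS](next_exp_cst ys us P e).
  apply: le_next_exp => //; first exact: history_bm_cst.
  exact: history_bm_lin.
have hist' y u : size (rcons us u) = (size (rcons ys y)).+1.
  by rewrite !size_rcons hist.
have q0 : 0 <= q%:num ^+ k by rewrite exprn_ge0.
have q1 : q%:num <= 1 by [].
rewrite /step /play /=; have [psia|psia] := eqVneq (arm ys us) a.
- rewrite psia nu'a /= add0r.
  (* The induction hypothesis is integrated under [nu a]; one factor of [q ^+ k.+1] then pays for
     moving the integral of [B] to the mixture. *)
  have : c - (q%:num ^+ k.+1 * j%:R + d * k.+1%:R) <=
      q%:num ^+ k.+1 * next_exp (nu a) B ys us + d * next_exp (nu a) A ys us.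
    apply: integrate => y u.
    have := IH k.+1 j (rcons ys y) (rcons us u) (hist' y u).
    rewrite -/A -/B => /(_ ltac:(lia)); rewrite !mulrDr; lra.
  have := le_next_exp_mix hist (nu a) q x0 bB (fun _ _ => B0 _ _).
  move=> /(ler_wpM2l q0); rewrite mulrA -exprSr.
  have : q%:num ^+ k.+1 * j%:R <= q%:num ^+ k * j%:R.
    by rewrite ler_wpM2r// exprS ler_piMl.
  rewrite -[k.+1%:R]natr1 !mulrDr.
  move: (q%:num ^+ k.+1 * _) (q%:num ^+ k * _) (q%:num ^+ k.+1 * _).
  move: (q%:num ^+ k * _) (next_exp (nu a) A ys us) => *; lra.
- rewrite nu'b//= add0r.
  (* Here both problems share the reward law and nothing is lost. *)
  have : c - (q%:num ^+ k * j.+1%:R + d * k%:R) <=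
      q%:num ^+ k * next_exp (nu (arm ys us)) B ys us +
      d * next_exp (nu (arm ys us)) A ys us.
    apply: integrate => y u.
    have := IH k j.+1 (rcons ys y) (rcons us u) (hist' y u).
    rewrite -/A -/B => /(_ ltac:(lia)); rewrite !mulrDr; lra.
  rewrite -[j.+1%:R]natr1 !mulrDr.
  move: (q%:num ^+ k * _) (q%:num ^+ k * _) (q%:num ^+ k * _).
  move: (next_exp _ A ys us) => *; lra.
Qed.

(** The empty past, [k = j = 0], averaged over the initial uniform variable. *)
Lemma expected_plays_transport (T : nat) (c d : R) : 0 <= d ->
  (forall k, (k <= T)%N -> c <= q%:num ^+ k * (T - k)%:R + d * k%:R) ->
  c <= expected_plays nu' T (predC1 a) + d * expected_plays nu T (pred1 a).
Proof.
move=> d0 base; rewrite /expected_plays.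
rewrite -!integral_total; [|exact: history_bm_play..].
rewrite -[X in X + _]mul1r -Rint_lin; last 2 first.
- exact/bm_initial/history_bm_total/history_bm_play.
- exact/bm_initial/history_bm_total/history_bm_play.
rewrite -(Rint_cst unif01 c); apply: le_Rint => [||u].
- exact: bm_cst.
- by apply: bm_lin; exact/bm_initial/history_bm_total/history_bm_play.
- have := transport_le d0 base (n := T) (k := 0) (j := 0)
    (ys := [::]) (us := [:: u]) erefl erefl.
  by rewrite expr0 !add0r.
Qed.

End change_of_measure.

(** * The lower bound on the regret *)

Section regret_lower_bound.
Context {R : realType} (K : nat) (psi : @strategy R K).
Hypothesis mpsi : strategy_measurable psi.
Variable D : @distr R -> Prop.
Hypothesis uD : unbounded_model D.
Hypothesis fast : uniformly_fast_convergent D psi.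
Variables (nu : 'I_K -> @distr R) (a : 'I_K).
Hypothesis Dnu : forall b, D (nu b).
Hypothesis gap_gt0 : 0 < gap nu a.

(* Meant for [s = sqrt T], [m = C ln T] and the [q] with [q ^ m = 1 / s]. *)
Lemma expected_plays_ge (nu' : 'I_K -> @distr R) (q : {i01 R}) (x0 : R)
    (T : nat) (m s : R) :
  nu' a = mix (nu a) q x0 -> (forall b, b != a -> nu' b = nu b) ->
  0 < m -> 0 < s -> s * s = T%:R -> m <= T%:R / 2 ->
  (forall k : nat, k%:R <= m -> s^-1 <= q%:num ^+ k) ->
  expected_plays psi nu' T (predC1 a) <= s / 8 ->
  m / 2 <= expected_plays psi nu T (pred1 a).
Proof.
move=> nu'a nu'b m0 s0 ssT mT qs Bs.
have sV0 : 0 < s^-1 by rewrite invr_gt0.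
pose c := s^-1 * (T%:R - m).
have c_ge : s / 2 <= c.
  have -> : s / 2 = s^-1 * (T%:R / 2) by rewrite -ssT; field; rewrite gt_eqF.
  by rewrite ler_pM2l//; lra.
have c0 : 0 < c by lra.
have cAB : c <= expected_plays psi nu' T (predC1 a) +
    c / m * expected_plays psi nu T (pred1 a).
  (* For [k <= m] the first term is at least [s^-1 * (T - m) = c]; for [k > m] the slope [c / m]
     reaches [c] alone. *)
  apply: (expected_plays_transport mpsi nu'a nu'b) => [|k kT].
    by rewrite divr_ge0 ?ltW.
  have kT' : k%:R <= T%:R :> R by rewrite ler_nat.
  rewrite natrB//; have [km|mk] := lerP k%:R m.
    apply: ler_wpDr; first by rewrite mulr_ge0 ?ler0n// divr_ge0 ?ltW.
    by apply: ler_pM; [exact: ltW|lra|exact: qs|lra].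
  apply: ler_wpDl; first by rewrite mulr_ge0 ?subr_ge0// exprn_ge0.
  by rewrite mulrAC ler_pdivlMr// ler_pM2l// ltW.
(* The other arms account for at most [s / 8 <= c / 4], which leaves more than [c / 2]. *)
rewrite -(ler_pM2l (divr_gt0 c0 m0)).
have -> : c / m * (m / 2) = c / 2 by field; rewrite gt_eqF.
lra.
Qed.

Lemma regret_ge_log (L : R) : 0 < L ->
  \forall T \near \oo, L <= regret nu psi T / ln T%:R.
Proof.
(* Only half of the [C ln T] plays is guaranteed, hence the factor 2. *)
move=> L0; pose C := 2 * L / gap nu a.
have C0 : 0 < C by rewrite divr_gt0// mulr_gt0.
(* With [q = exp (- w)], [q] to the power [C ln T] is [1 / sqrt T]. As [q] does not depend on [T],
   fast convergence is applied to a single modified problem. *)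
pose w := (2 * C)^-1.
have w0 : 0 < w by rewrite invr_gt0 mulr_gt0.
have q0 : 0 < expR (- w) by exact: expR_gt0.
have q1 : expR (- w) < 1 by rewrite expR_lt1 oppr_lt0.
pose q : {i01 R} := Itv01 (ltW q0) (ltW q1).
have [x0 [_ DQ muQ]] := exists_mix_mean_gt (q := q) (mustar nu) uD (Dnu a) q1.
pose Q : @distr R := mix (nu a) q x0.
pose nu' (b : 'I_K) : @distr R := if b == a then Q else nu b.
have nu'a : nu' a = Q by rewrite /nu' eqxx.
have nu'b b : b != a -> nu' b = nu b by rewrite /nu' => /negbTE ->.
have Dnu' b : D (nu' b) by rewrite /nu'; case: ifP.
pose g := mean Q - mustar nu.
have g0 : 0 < g by rewrite subr_gt0.
have gB T : g * expected_plays psi nu' T (predC1 a) <= regret nu' psi T.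
  apply: regret_ge => // b /=; have [->|ba] := eqVneq b a.
    by rewrite mulr0 addr0 mean_le_mustar.
  rewrite mulr1 nu'b// /g.
  have := mean_le_mustar nu' a; rewrite nu'a; have := mean_le_mustar nu b; lra.
have gA T : gap nu a * expected_plays psi nu T (pred1 a) <= regret nu psi T.
  apply: regret_ge => // b /=; have [->|ba] := eqVneq b a.
    by rewrite mulr1 /gap addrC subrK.
  by rewrite mulr0 addr0 mean_le_mustar.
have half : 0 < (2^-1 : R) <= 1 by apply/andP; split; lra.
have g8 : 0 < g / 8 by lra.
near=> T.
have T2 : 2 <= T%:R :> R by near: T; exact: nbhs_infty_ger.
(* This says [4 C <= s]; with [ln s < s] it gives [C ln T = 2 C ln s <= 2 C s <= T / 2]. *)
have TC : 16 * C * C <= T%:R by near: T; exact: nbhs_infty_ger.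
(* Each play of another arm costs at least [g] in [nu'], so this leaves at most [s / 8] such
   plays. *)
have small : regret nu' psi T / (T%:R `^ 2^-1) < g / 8.
  near: T; exact: (cvgr_lt _ (fast Dnu' half)).
have T0 : 0 < T%:R :> R by lra.
have lnT0 : 0 < ln T%:R :> R by rewrite ln_gt0//; lra.
pose s : R := T%:R `^ 2^-1.
have s0 : 0 < s by exact: powR_gt0.
have ssT : s * s = T%:R.
  rewrite -powRD; last by rewrite gt_eqF ?implybT.
  by rewrite (_ : _ + _ = 1); [rewrite powRr1// ltW|lra].
have lns : ln s = ln T%:R / 2 by rewrite ln_powR mulrC.
have s4C : 4 * C <= s.
  have [C0' s0'] : 0 <= 4 * C /\ 0 <= s by split; lra.
  by rewrite -(ler_pXn2r (n := 2))// !expr2 ssT; lra.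
have plays : C * ln T%:R / 2 <= expected_plays psi nu T (pred1 a).
  apply: (expected_plays_ge (m := C * ln T%:R) (s := s) nu'a nu'b) => //.
  - exact: mulr_gt0.
  - have : ln s < s by exact: ln_sublinear.
    rewrite lns => lnTs.
    have : C * ln T%:R <= C * (2 * s) by rewrite ler_pM2l//; lra.
    have : 4 * C * s <= T%:R by rewrite -ssT ler_pM2r.
    lra.
  - move=> k km; rewrite /= -expRM_natl -[s^-1]lnK ?posrE ?invr_gt0//.
    rewrite ler_expR lnV ?posrE// lns.
    have -> : ln T%:R / 2 = w * (C * ln T%:R).
      by rewrite /w; field; rewrite gt_eqF.
    by rewrite mulrN lerN2 mulrC ler_pM2l.
  - rewrite -(ler_pM2l g0); apply: le_trans (gB T) _.
    by move: small; rewrite -/s ltr_pdivrMr//; lra.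
rewrite ler_pdivlMr//; apply: le_trans (gA T).
have -> : L * ln T%:R = gap nu a * (C * ln T%:R / 2).
  by rewrite /C; field; rewrite gt_eqF.
by rewrite ler_pM2l.
Unshelve. all: by end_near. Qed.

Lemma liminf_regret_eq_pinfty : liminf_regret_over_log nu psi = +oo%E.
Proof.
rewrite /liminf_regret_over_log.
apply: (cvg_limn_einf_sup _).1; apply/cvgeryP/cvgryPge => A.
have [A0|A0] := ltP 0 A; first exact: regret_ge_log.
by near=> T; apply: (le_trans (y := 1)); [lra|near: T; exact: regret_ge_log].
Unshelve. all: by end_near. Qed.

End regret_lower_bound.

Theorem theorem4 (R : realType) (K : nat) (HK : (2 <= K)%N) :
  (* the model D_{-,+} *)
  ((forall nu : 'I_K -> @distr R, (forall k, in_Dmp (nu k)) ->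
      forall a : 'I_K, 0 < gap nu a ->
        Kinf (nu a) (mustar nu) in_Dmp = 0%E)
   /\
   (forall psi : @strategy R K, strategy_measurable psi ->
      uniformly_fast_convergent in_Dmp psi ->
      forall nu : 'I_K -> @distr R, (forall k, in_Dmp (nu k)) ->
        (exists a : 'I_K, 0 < gap nu a) ->
        liminf_regret_over_log nu psi = +oo%E))
  /\
  (* the models D_{m,+}, m real *)
  (forall m : R,
    (forall nu : 'I_K -> @distr R, (forall k, in_Dmplus m (nu k)) ->
      forall a : 'I_K, 0 < gap nu a ->
        Kinf (nu a) (mustar nu) (in_Dmplus m) = 0%E)
    /\
    (forall psi : @strategy R K, strategy_measurable psi ->
      uniformly_fast_convergent (in_Dmplus m) psi ->
      forall nu : 'I_K -> @distr R, (forall k, in_Dmplus m (nu k)) ->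
        (exists a : 'I_K, 0 < gap nu a) ->
        liminf_regret_over_log nu psi = +oo%E)).
Proof.
split; last move=> m; split.
- move=> nu Dnu a _.
  exact: (Kinf_eq0 (mustar nu) unbounded_model_Dmp (Dnu a)).
- move=> psi mpsi fast nu Dnu [a gap0].
  exact: (liminf_regret_eq_pinfty mpsi unbounded_model_Dmp fast Dnu gap0).
- move=> nu Dnu a _.
  exact: (Kinf_eq0 (mustar nu) (@unbounded_model_Dmplus R m) (Dnu a)).
- move=> psi mpsi fast nu Dnu [a gap0].
  exact: (liminf_regret_eq_pinfty mpsi (@unbounded_model_Dmplus R m) fast Dnu
    gap0).
Qed.
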